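(* Let $M\in\mathbb{Z}^{m\times n}$ be a unimodular matrix. Suppose $\bm{b},\bm{b}^+,\bm{b}^-\in\mathbb{Z}^m$ are integer vectors such that $\bm{b} = \frac{\bm{b}^+ + \bm{b}^-}{2}$. Then for any $\bm{k}_1, \bm{k}_2\in\mathbb{Z}^n$, \[ T(\bm{b}, \bm{k}_1, \bm{k}_2; \bm{w})^2 - T(\bm{b}^+, \bm{k}_1, \bm{k}_2; \bm{w}) \cdot T(\bm{b}^-, \bm{k}_1, \bm{k}_2; \bm{w}) \] is a Laurent polynomial in $\bm{w}=(w_1,\ldots,w_n)$ with nonnegative coefficients.
   Context: An integer matrix $M$ is unimodular if all of its non-singular $\operatorname{rank}(M)\times\operatorname{rank}(M)$ submatrices have determinant $\pm1$. For $\bm{b}\in\mathbb{Z}^m$ and $\bm{k}_1,\bm{k}_2\in\mathbb{Z}^n$, \[ T(\bm{b}, \bm{k}_1, \bm{k}_2; \bm{w}) = \sum_{\substack{\bm{y}\in\mathbb{Z}^n,\ \bm{k}_1 \le \bm{y} \le \bm{k}_2 \\ M \bm{y} = \bm{b}}} \bm{w}^{\bm{y}},\qquad \bm{w}^{\bm{y}}=\prod_{j=1}^n w_j^{y_j}, \] where inequalities between vectors are entrywise. *)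

(* Defs.v *)
From HB Require Import structures.
From mathcomp Require Import all_boot all_order all_algebra.
From mathcomp Require Import mpoly.
From mathcomp Require Import classical_sets cardinality fsbigop.

Set Implicit Arguments.
Unset Strict Implicit.
Unset Printing Implicit Defensive.
Import Order.TTheory GRing.Theory Num.Theory.
Local Open Scope classical_set_scope.
Local Open Scope ring_scope.

Definition ratmx (m n : nat) (A : 'M[int]_(m, n)) : 'M[rat]_(m, n) :=
  map_mx (intr : int -> rat) A.

(* The rank of an integer matrix is its rank over the field of rationals. *)
Definition int_rank (m n : nat) (M : 'M[int]_(m, n)) : nat := \rank (ratmx M).

Definition increasing_ord (r n : nat) (f : 'I_r -> 'I_n) : Prop :=
  forall i j : 'I_r, (i < j)%N -> (f i < f j)%N.

Definition unimodular (m n : nat) (M : 'M[int]_(m, n)) : Prop :=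
  forall (f : 'I_(int_rank M) -> 'I_m) (g : 'I_(int_rank M) -> 'I_n),
    increasing_ord f -> increasing_ord g ->
    \det (mxsub f g M) != 0 ->
    \det (mxsub f g M) = 1 \/ \det (mxsub f g M) = -1.

Definition lecV (n : nat) (u v : 'cV[int]_n) : Prop :=
  forall j : 'I_n, u j 0 <= v j 0.

(* Laurent polynomials in w_1, ..., w_n with integer coefficients are viewed
   inside the fraction field of Z[w_1, ..., w_n], in which the Laurent
   polynomial ring embeds as the Z-span of the monomials below. *)
Definition ratfrac (n : nat) := {fraction {mpoly int[n]}}.

(* The exponents are of type int: [^] is integer exponentiation. *)
Definition monomial (n : nat) (y : 'cV[int]_n) : ratfrac n :=
  \prod_(j < n) (FracField.tofrac ('X_j : {mpoly int[n]})) ^ (y j 0).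

Definition T (m n : nat) (M : 'M[int]_(m, n)) (b : 'cV[int]_m)
    (k1 k2 : 'cV[int]_n) : ratfrac n :=
  \sum_(y \in [set y : 'cV[int]_n | [/\ lecV k1 y, lecV y k2 & M *m y = b]])
    monomial y.

(* Sums indexed by [\in] are zero by convention when the support is infinite;
   this does not happen in the definition of T. *)
Lemma finite_box (n : nat) (k1 k2 : 'cV[int]_n) :
  finite_set [set y : 'cV[int]_n | lecV k1 y /\ lecV y k2].
Proof.
pose N := \max_(j < n) absz (k2 j 0 - k1 j 0)%R.
pose h (f : {ffun 'I_n -> 'I_N.+1}) : 'cV[int]_n :=
  \col_j (k1 j 0 + (f j : nat)%:Z).
apply: (@sub_finite_set _ _ (h @` setT)); last exact/finite_image/finite_finset.
move=> y [k1y yk2]; exists [ffun j => inord (absz (y j 0 - k1 j 0)%R)] => //.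
apply/matrixP => j i; rewrite !mxE ffunE ord1 inordK.
  by rewrite gez0_abs ?subr_ge0 // addrC subrK.
rewrite ltnS; apply: (@leq_trans (absz (k2 j 0 - k1 j 0)%R)).
  rewrite -lez_nat !gez0_abs ?subr_ge0 ?lerB //.
  exact: le_trans (k1y j) (yk2 j).
exact: (@leq_bigmax _ (fun j => absz (k2 j 0 - k1 j 0)%R)).
Qed.

(* The coefficient family c is determined by p, since distinct Laurent
   monomials are linearly independent over Z. *)
Definition laurent_with_coeffs (n : nat) (c : 'cV[int]_n -> int)
    (p : ratfrac n) : Prop :=
  finite_set [set y : 'cV[int]_n | c y != 0] /\
  p = \sum_(y \in [set: 'cV[int]_n]) (c y)%:~R * monomial y.

Definition laurent_nonneg (n : nat) (p : ratfrac n) : Prop :=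
  exists c : 'cV[int]_n -> int,
    laurent_with_coeffs c p /\ forall y : 'cV[int]_n, 0 <= c y.

(* Main.v *)
(** Write [N(b, l, u)] for the number of integer points [y] of the box
    [l <= y <= u] with [M y = b]. The pairs [(y, y')] in [k1, k2] with
    [M y = b1], [M y' = b2] and fixed sum [v] are the points of a smaller box,
    symmetric about [v / 2], lying over [b1]; so the theorem says that
    [N(b', l, u) <= N(b, l, u)] whenever [M (l + u) = 2 b].

    This is proved by induction on the size of the box. Put [b'' = 2 b - b'];
    the reflection [y -> l + u - y] gives [N(b') = N(b'')]. Sort the pairs counted
    by [N(b') N(b'') = N(b') ^ 2], and those counted by [N(b) ^ 2], according to
    their sum [v]. For [v <> l + u] the pairs live in a strictly smaller box and
    the induction applies; for [v = l + u] there are [N(b')], respectively [N(b)],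
    of them. Hence [N(b') ^ 2 - N(b') <= N(b) ^ 2 - N(b)], which suffices as soon
    as [N(b) > 0]. Unimodularity enters only there: the rational point
    [(l + u) / 2] of the fiber can be pushed along kernel vectors of [M] until its
    fractional columns are independent, and it is then integral by Cramer's
    rule. *)

Require Import Defs.
From mathcomp Require Import all_boot all_order all_algebra.
From mathcomp Require Import perm zify lra finmap.
From mathcomp Require Import mpoly.
From mathcomp Require Import classical_sets cardinality fsbigop.
Import Order.TTheory GRing.Theory Num.Theory.
Local Open Scope ring_scope.

Set Implicit Arguments.
Unset Strict Implicit.
Unset Printing Implicit Defensive.

(** * Nonsingular minors and extension of independent rows to bases *)

(** [unimodular] only tests increasing selections, whereas bases found by extension come in
    arbitrary order. Here [g] lists the image of [f] in order and [s] sends [i] to the rank of [f i]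
    in it. *)
Lemma injective_increasing_perm (r n : nat) (f : 'I_r -> 'I_n) :
  injective f ->
  exists (g : 'I_r -> 'I_n) (s : 'S_r), increasing_ord g /\ f =1 g \o s.
Proof.
move=> f_inj; pose P := [set f i | i in 'I_r]%SET.
have cardP : #|P| = r by rewrite card_imset // card_ord.
pose g (i : 'I_r) : 'I_n := Order.enum_val (cast_ord (esym cardP) i).
have fP i : f i \in P by exact: imset_f.
pose t i : 'I_r := cast_ord cardP (Order.enum_rank_in (fP i) (f i)).
have gt i : g (t i) = f i.
  by rewrite /g /t cast_ordK Order.enum_rankK_in.
have t_inj : injective t by move=> i j tij; apply: f_inj; rewrite -!gt tij.
exists g, (perm t_inj); split=> [i j ij|i]; last by rewrite /= permE gt.
have := leW_mono (Order.le_enum_val (@le_total _ _) (A := P)) (cast_ord (esym cardP) i)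
  (cast_ord (esym cardP) j).
by rewrite !ltEord /= ij.
Qed.

(** Sorting the selected rows and columns multiplies the minor by permutation matrices, which
    changes its determinant only by a sign. *)
Lemma unimodular_det_unit (m n : nat) (M : 'M[int]_(m, n))
    (f : 'I_(int_rank M) -> 'I_m) (g : 'I_(int_rank M) -> 'I_n) :
  unimodular M -> injective f -> injective g ->
  \det (mxsub f g M) != 0 -> mxsub f g M \in unitmx.
Proof.
move=> hM /injective_increasing_perm[f' [s [f'_inc fE]]].
move=> /injective_increasing_perm[g' [t [g'_inc gE]]].
have -> : mxsub f g M = perm_mx s *m mxsub f' g' M *m (perm_mx t)^T.
  rewrite tr_perm_mx -row_permE -col_permE.
  by apply/matrixP=> i j; rewrite !mxE fE gE.
rewrite tr_perm_mx !det_mulmx !det_perm -mulrA mulf_eq0 signr_eq0 /=.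
rewrite mulf_eq0 signr_eq0 orbF => det_neq0.
rewrite unitmx_mul unitmx_mul !unitmx_perm andbT /=.
by case: (hM f' g' f'_inc g'_inc det_neq0); rewrite unitmxE => ->.
Qed.

(** A repeated row would give two equal rows in the product with a right inverse, which is the
    identity. *)
Lemma rowsub_free_inj (F : fieldType) (m n k : nat) (B : 'M[F]_(m, n))
    (h : 'I_k -> 'I_m) : row_free (rowsub h B) -> injective h.
Proof.
move=> /row_freeP[C hC] i j hij; apply/eqP.
have := congr1 (fun X : 'M_k => X i i) hC; have := congr1 (fun X : 'M_k => X j i) hC.
rewrite mul_rowsub_mx !mxE hij => -> /eqP.
by rewrite eqxx [j == i]eq_sym; case: (i == j); rewrite // eq_sym oner_eq0.
Qed.

(** While fewer than [\rank B] rows are chosen, some row of [B] lies outside their span and can be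
    added; the induction is on the number of missing rows. *)
Lemma row_free_extend (F : fieldType) (m n k r : nat) (B : 'M[F]_(m, n))
    (h : 'I_k -> 'I_m) : \rank B = r -> row_free (rowsub h B) ->
  exists g : 'I_r -> 'I_m,
    row_free (rowsub g B) /\ forall i, exists j, h i = g j.
Proof.
move=> <-.
have [d] := ubnP (\rank B - k)%N; elim: d k h => // d IHd k h lt_d h_free.
have le_kr : (k <= \rank B)%N.
  by rewrite -(eqP h_free) rowsubE mxrankM_maxr.
have [eq_kr|ne_kr] := eqVneq k (\rank B).
  by move: h h_free lt_d; rewrite eq_kr => h h_free _; exists h; split=> // i; exists i.
have lt_kr : (k < \rank B)%N by rewrite ltn_neqAle ne_kr.
have : ~~ (B <= rowsub h B)%MS.
  by apply: contraL lt_kr => /mxrankS; rewrite (eqP h_free) -leqNgt.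
case/row_subPn=> i0 i0B.
pose h' (i : 'I_(1 + k)) := match split i with inl _ => i0 | inr j => h j end.
have h'E : rowsub h' B = col_mx (row i0 B) (rowsub h B).
  apply/row_matrixP=> i; rewrite row_rowsub /h' -{2}(splitK i).
  by case: (split i) => j /=; rewrite ?rowKu ?rowKd ?row_rowsub // row_id.
have h'_free : row_free (rowsub h' B).
  rewrite -row_leq_rank h'E -addsmxE.
  apply: leq_trans (_ : \rank (rowsub h B) < _)%N.
    by rewrite (eqP h_free).
  rewrite ltnNge; apply: contra i0B => le.
  have := geq_leqif (mxrank_leqif_eq (addsmxSr (row i0 B) (rowsub h B))).
  rewrite le => /esym/andP[_]; apply: submx_trans; exact: addsmxSl.
case: (IHd (1 + k)%N h' _ h'_free) => [|g [g_free h'g]].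
  by rewrite -ltnS; apply: leq_trans lt_d; rewrite ltnS ltn_sub2l.
exists g; split=> // i; case: (h'g (rshift 1 i)) => j hj; exists j.
by rewrite -hj /h' (unsplitK (inr i)).
Qed.

(** * Integral points in the fibers of a unimodular matrix *)

(** The columns carrying [y] extend to a column basis [g]; rows [f] then cut out a nonsingular minor
    [K]. The coordinates of [y] along [g] solve a system with matrix [K] and integral right-hand
    side, and [K] is invertible over the integers. *)
Lemma unimodular_basic_integral (m n k : nat) (M : 'M[int]_(m, n))
    (b : 'cV[int]_m) (h : 'I_k -> 'I_n) (y : 'cV[rat]_n) :
  unimodular M -> row_free (rowsub h (ratmx M)^T) ->
  (forall j, y j 0 != 0 -> exists i, j = h i) ->
  ratmx M *m y = ratmx b -> exists x : 'cV[int]_n, y = ratmx x.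
Proof.
move=> hM h_free y_supp My.
have [g [g_free hg]] := row_free_extend (mxrank_tr (ratmx M)) h_free.
have g_inj := rowsub_free_inj g_free.
have rankC : \rank (colsub g (ratmx M)) = int_rank M.
  by rewrite -mxrank_tr trmx_mxsub (eqP g_free).
(* The empty selection is free, so extending it produces a row basis. *)
have h0_free : row_free (rowsub (fun i : 'I_0 => widen_ord (leq0n m) i)
                           (colsub g (ratmx M))).
  by rewrite /row_free eqn_leq rank_leq_row.
have [f [f_free _]] := row_free_extend rankC h0_free.
have f_inj := rowsub_free_inj f_free.
pose K := mxsub f g M.
have KE : ratmx K = rowsub f (colsub g (ratmx M)).
  by apply/matrixP=> i j; rewrite !mxE.
have Ku : K \in unitmx.
  apply: unimodular_det_unit => //.
  rewrite row_free_unit -KE unitmxE unitfE det_map_mx in f_free.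
  by rewrite intr_eq0 in f_free.
pose E : 'M[int]_(n, int_rank M) := colsub g 1%:M.
have yE : y = ratmx E *m rowsub g y.
  apply/matrixP=> j i; rewrite ord1 mxE.
  have [yj0|/y_supp[i0 ->]] := eqVneq (y j 0) 0.
    rewrite big1 // => l _; rewrite !mxE.
    by case: eqVneq => [<-|_]; rewrite ?yj0 ?mulr0 ?mul0r.
  have [l ->] := hg i0.
  rewrite (bigD1 l) //= !mxE eqxx mul1r big1 ?addr0 // => l' ne.
  by rewrite !mxE (inj_eq g_inj) eq_sym (negPf ne) mul0r.
suff gyE : rowsub g y = ratmx (invmx K *m rowsub f b).
  by exists (E *m (invmx K *m rowsub f b)); rewrite yE gyE /ratmx [RHS]map_mxM.
have : ratmx K *m rowsub g y = ratmx (rowsub f b).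
  rewrite KE mul_rowsub_mx.
  have -> : ratmx (rowsub f b) = rowsub f (ratmx b).
    by apply/matrixP=> i j; rewrite !mxE.
  rewrite -My [in RHS]yE mulmxA; congr (rowsub f (_ *m _)).
  have -> : ratmx E = colsub g 1%:M.
    by apply/matrixP=> i j; rewrite !mxE; case: eqP.
  by rewrite mulmx_colsub mulmx1.
move/(congr1 (mulmx (ratmx (invmx K)))).
rewrite mulmxA -[ratmx _ *m ratmx K]map_mxM mulVmx // map_mx1 mul1mx => ->.
by rewrite /ratmx [RHS]map_mxM.
Qed.

(** Induction on the number of fractional coordinates of [y], collected in [F y]. *)
Lemma unimodular_box_integral (m n : nat) (M : 'M[int]_(m, n))
    (b : 'cV[int]_m) (l u : 'cV[int]_n) (y : 'cV[rat]_n) :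
  unimodular M -> (forall j, (l j 0)%:~R <= y j 0 <= (u j 0)%:~R) ->
  ratmx M *m y = ratmx b ->
  exists x : 'cV[int]_n, [/\ lecV l x, lecV x u & M *m x = b].
Proof.
move=> hM; pose F (z : 'cV[rat]_n) := [set j | z j 0 \isn't a Num.int]%SET.
have [d] := ubnP #|F y|; elim: d y => // d IHd y lt_d lyu My.
pose h (i : 'I_#|F y|) : 'I_n := enum_val i.
have [h_free|h_dep] := boolP (row_free (rowsub h (ratmx M)^T)).
  (* Subtracting the floors leaves a vector supported on the independent fractional columns, over a
     right-hand side that is still integral. *)
  pose w : 'cV[int]_n := \col_j Num.floor (y j 0).
  have supp j : (y - ratmx w) j 0 != 0 -> exists i, j = h i.
    rewrite !mxE subr_eq0 eq_sym -intrEfloor => yj.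
    have jF : j \in F y by rewrite inE.
    by exists (enum_rank_in jF j); rewrite /h enum_rankK_in.
  have Mw : ratmx M *m (y - ratmx w) = ratmx (b - M *m w).
    by rewrite mulmxBr My /ratmx map_mxB map_mxM.
  have [x /eqP] := unimodular_basic_integral hM h_free supp Mw.
  rewrite subr_eq /ratmx -map_mxD -/(ratmx _) => /eqP yE.
  exists (x + w); split=> [j|j|].
  - by have /andP[+ _] := lyu j; rewrite yE mxE ler_int.
  - by have /andP[_ +] := lyu j; rewrite yE mxE ler_int.
  - apply/matrixP=> i j; move: My; rewrite yE -[LHS]map_mxM.
    by move/matrixP/(_ i j); rewrite !mxE => /intr_inj.
have /rowV0Pn[w /sub_kermxP wM w_neq0] : kermx (rowsub h (ratmx M)^T) != 0.
  by rewrite kermx_eq0.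
have vE j : (w *m rowsub h 1%:M)^T j 0 = \sum_i w 0 i * (h i == j)%:R.
  by rewrite !mxE; apply: eq_bigr => i _; rewrite !mxE.
(* The dependency between fractional columns, extended by zero: a kernel vector of [M] supported on
   [F y]. *)
set v : 'cV_n := (w *m rowsub h 1%:M)^T in vE.
have Mv : ratmx M *m v = 0.
  by apply: trmx_inj; rewrite trmx_mul trmxK -mulmxA -rowsubE wM trmx0.
have vF j : j \notin F y -> v j 0 = 0.
  move=> jF; rewrite vE big1 // => i _; case: eqP => [hij|_]; last by rewrite mulr0.
  by move: jF; rewrite -hij enum_valP.
have [j0 vj0] : exists j, v j 0 != 0.
  have /rV0Pn[i wi] := w_neq0; exists (h i); rewrite vE (bigD1 i) //= eqxx mulr1.
  rewrite big1 ?addr0 // => i' ne.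
  by rewrite (inj_eq enum_val_inj) (negPf ne) mulr0.
(* Moving from [y] along [v], coordinate [j] first reaches an integer at [c j], at time [t j].
   Stopping at the least such time keeps every coordinate between its floor and its ceiling. *)
pose c j : rat := (if 0 < v j 0 then Num.ceil (y j 0) else Num.floor (y j 0))%:~R.
pose t j := (c j - y j 0) / v j 0.
have [j1 vj1 t_min] := @arg_minP _ _ _ j0 (fun j => v j 0 != 0) t vj0.
pose y' := y + t j1 *: v.
have y'E j : y' j 0 = y j 0 + t j1 * v j 0 by rewrite !mxE.
have t_ge0 j : v j 0 != 0 -> 0 <= t j.
  rewrite /t /c; case: ltrgt0P => // vj _.
    by rewrite divr_ge0 ?subr_ge0 ?ceil_ge // ltW.
  by rewrite mulr_le0 ?subr_le0 ?floor_le // invr_le0 ltW.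
have y'_itv j : (Num.floor (y j 0))%:~R <= y' j 0 <= (Num.ceil (y j 0))%:~R.
  have flc := floor_le (y j 0); have cel := ceil_ge (y j 0).
  rewrite y'E; have [->|vj] := eqVneq (v j 0) 0; first by rewrite mulr0 addr0 flc.
  have t1 := t_ge0 _ vj1; have := t_min j vj; rewrite {2}/t /c.
  case: ltrgt0P vj => // vj _.
    rewrite ler_pdivlMr // => le_t; rewrite -lerBrDl le_t andbT.
    by rewrite (le_trans flc) // lerDl mulr_ge0 // ltW.
  rewrite ler_ndivlMr // => le_t; rewrite -lerBlDl le_t /=.
  by rewrite (le_trans _ cel) // gerDl mulr_ge0_le0 // ltW.
apply: (IHd y').
- rewrite -ltnS; apply: leq_trans lt_d; rewrite ltnS.
  (* Integral coordinates do not move, and coordinate [j1] has become integral. *)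
  apply/proper_card/properP; split.
    apply/fintype.subsetP=> j; rewrite inE; apply: contraR => /[dup] jF.
    by rewrite inE negbK y'E vF // mulr0 addr0.
  exists j1; first by apply: contraR vj1 => /vF ->.
  rewrite inE negbK y'E /t divfK // addrC subrK /c.
  by case: ifP => _; apply: intr_int.
(* The bounds [l] and [u] are integral, so rounding [y] down or up does not cross them. *)
- move=> j; have /andP[lj uj] := lyu j; have /andP[fj cj] := y'_itv j.
  apply/andP; split.
    by apply: le_trans fj; rewrite ler_int floor_ge_int.
  by apply: le_trans cj _; rewrite ler_int ceil_le_int.
- by rewrite mulmxDr My -scalemxAr Mv scaler0 addr0.
Qed.

(* Convertible instances of the ring of entries prevent [lia] from identifying
   equal matrix entries, hence the generalization. *)
Ltac lia_entries :=
  rewrite !mxE;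
  repeat match goal with |- context [fun_of_matrix ?A ?i ?j] =>
    move: (A i j) => ?
  end; lia.

(** * Counting fiber points and pairs with a given sum *)

Definition box (n : nat) (l u : 'cV[int]_n) : seq 'cV[int]_n :=
  fset_set [set y | lecV l y /\ lecV y u]%classic.

Definition fiber (m n : nat) (M : 'M[int]_(m, n)) (b : 'cV[int]_m)
    (l u : 'cV[int]_n) : seq 'cV[int]_n :=
  [seq y <- box l u | M *m y == b].

(** This is the coefficient of [w^v] in the product of the sums over the two fibers; a pair is
    recorded by its first member [y], the second being [v - y]. *)
Definition pairs (m n : nat) (M : 'M[int]_(m, n)) (b1 b2 : 'cV[int]_m)
    (l u v : 'cV[int]_n) : nat :=
  count (fun y => v - y \in fiber M b2 l u) (fiber M b1 l u).

Lemma mem_box (n : nat) (l u y : 'cV[int]_n) :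
  reflect (lecV l y /\ lecV y u) (y \in box l u).
Proof.
rewrite /box in_fset_set; last exact: finite_box.
by apply: (iffP idP); rewrite in_setE.
Qed.

Lemma mem_fiber (m n : nat) (M : 'M[int]_(m, n)) (b : 'cV[int]_m)
    (l u y : 'cV[int]_n) :
  reflect [/\ lecV l y, lecV y u & M *m y = b] (y \in fiber M b l u).
Proof.
rewrite mem_filter; apply: (iffP andP) => [[/eqP <- /mem_box[]]|[ly yu <-]] //.
by split=> //; apply/mem_box.
Qed.

Lemma uniq_box (n : nat) (l u : 'cV[int]_n) : uniq (box l u).
Proof. exact: fset_uniq. Qed.

Lemma uniq_fiber (m n : nat) (M : 'M[int]_(m, n)) (b : 'cV[int]_m)
    (l u : 'cV[int]_n) : uniq (fiber M b l u).
Proof. by rewrite filter_uniq ?uniq_box. Qed.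

Lemma size_fiber_reflect (m n : nat) (M : 'M[int]_(m, n)) (b : 'cV[int]_m)
    (l u : 'cV[int]_n) :
  size (fiber M (M *m (l + u) - b) l u) = size (fiber M b l u).
Proof.
rewrite -(size_map (fun y => l + u - y) (fiber M b l u)).
apply/perm_size/uniq_perm; rewrite ?uniq_fiber //.
  by rewrite map_inj_uniq ?uniq_fiber // => y y' /addrI/oppr_inj.
have refl_fiber b' y : y \in fiber M b' l u ->
    l + u - y \in fiber M (M *m (l + u) - b') l u.
  move=> /mem_fiber[ly yu <-]; apply/mem_fiber; split; last by rewrite mulmxBr.
    by move=> j; have := yu j; lia_entries.
  by move=> j; have := ly j; lia_entries.
move=> y; apply/idP/mapP => [/refl_fiber|[y' /refl_fiber y'b ->]] //.
by rewrite subKr => yb; exists (l + u - y); rewrite ?subKr.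
Qed.

Definition vmax (n : nat) (u v : 'cV[int]_n) : 'cV[int]_n :=
  \col_j Num.max (u j 0) (v j 0).

Definition vmin (n : nat) (u v : 'cV[int]_n) : 'cV[int]_n :=
  \col_j Num.min (u j 0) (v j 0).

(** The bounds [l <= v - y <= u] read [v - u <= y <= v - l], and the equation for [v - y] follows
    from the one for [y]. *)
Lemma pairs_fiber (m n : nat) (M : 'M[int]_(m, n)) (b1 b2 : 'cV[int]_m)
    (l u v : 'cV[int]_n) : M *m v = b1 + b2 ->
  pairs M b1 b2 l u v = size (fiber M b1 (vmax l (v - u)) (vmin u (v - l))).
Proof.
move=> Mv; rewrite /pairs -size_filter.
apply/perm_size/uniq_perm => [||y]; rewrite ?(filter_uniq, uniq_box) //.
rewrite mem_filter; apply/andP/mem_fiber => [[]|[ly yu My]].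
  move=> /mem_fiber[lvy vyu _] /mem_fiber[ly yu My]; split=> // j.
    by have := ly j; have := vyu j; lia_entries.
  by have := yu j; have := lvy j; lia_entries.
split; apply/mem_fiber; split=> //.
- by move=> j; have := yu j; lia_entries.
- by move=> j; have := ly j; lia_entries.
- by rewrite mulmxBr Mv My addrC addKr.
- by move=> j; have := ly j; lia_entries.
- by move=> j; have := yu j; lia_entries.
Qed.

Lemma pairs_eq0 (m n : nat) (M : 'M[int]_(m, n)) (b1 b2 : 'cV[int]_m)
    (l u v : 'cV[int]_n) : M *m v != b1 + b2 -> pairs M b1 b2 l u v = 0%N.
Proof.
move=> Mv; apply/eqP; rewrite -leqn0 leqNgt -has_count; apply: contra Mv.
case/hasP=> y /mem_fiber[_ _ <-] /mem_fiber[_ _ <-].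
by rewrite mulmxBr addrC subrK.
Qed.

(** Stated for a general [F] to serve twice: the constant 1 counts pairs, monomials give products of
    the sums [T]. *)
Lemma sum_pairs (R : nmodType) (m n : nat) (M : 'M[int]_(m, n))
    (b1 b2 : 'cV[int]_m) (l u : 'cV[int]_n) (F : 'cV[int]_n -> R) :
  \sum_(y1 <- fiber M b1 l u) \sum_(y2 <- fiber M b2 l u) F (y1 + y2) =
  \sum_(v <- box (l + l) (u + u)) F v *+ pairs M b1 b2 l u v.
Proof.
under [RHS]eq_bigr do rewrite /pairs -sum1_count -sumrMnr.
under [RHS]eq_bigr do rewrite big_mkcond.
rewrite [RHS]exchange_big /= [LHS]big_seq [RHS]big_seq; apply: eq_bigr => y1 /mem_fiber[ly1 y1u _].
rewrite -[RHS]big_mkcond -[RHS]big_filter -(big_map (+%R y1) xpredT F).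
apply: perm_big; apply: uniq_perm; rewrite ?filter_uniq ?uniq_box //.
  by rewrite map_inj_uniq ?uniq_fiber //; apply: addrI.
move=> v; rewrite mem_filter; apply/mapP/andP => [[y2 y2b ->]|[vb _]].
  have /mem_fiber[ly2 y2u _] := y2b.
  rewrite [y1 + y2]addrC addrK; split=> //; apply/mem_box.
  by split=> j; rewrite !mxE lerD.
by exists (v - y1); rewrite // addrC subrK.
Qed.

Lemma size_fiberM (m n : nat) (M : 'M[int]_(m, n)) (b1 b2 : 'cV[int]_m)
    (l u : 'cV[int]_n) :
  (size (fiber M b1 l u) * size (fiber M b2 l u))%N =
  (\sum_(v <- box (l + l) (u + u)) pairs M b1 b2 l u v)%N.
Proof.
rewrite -!sum1_size big_distrlr /=.
rewrite [LHS](sum_pairs M b1 b2 l u (fun=> 1%N)).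
by apply: eq_bigr => v _; rewrite -[LHS]mulr_natr mul1r natn.
Qed.

(** * The central fiber of a box is the largest *)

Lemma fiber_midpoint (m n : nat) (M : 'M[int]_(m, n)) (b : 'cV[int]_m)
    (l u : 'cV[int]_n) : unimodular M -> lecV l u -> M *m (l + u) = b + b ->
  (0 < size (fiber M b l u))%N.
Proof.
move=> hM lu Mlu.
have [j||x [lx xu Mx]] := @unimodular_box_integral _ _ M b l u
    (2^-1 *: ratmx (l + u)) hM.
- have := lu j; rewrite -(ler_int rat) !mxE intrD => luj.
  by apply/andP; split; lra.
- rewrite -scalemxAr -[_ *m _]map_mxM Mlu /= map_mxD -mulr2n -scaler_nat.
  by rewrite scalerA mulVf ?scale1r.
by rewrite -has_predT; apply/hasP; exists x; rewrite //; apply/mem_fiber.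
Qed.

(** In coordinate [j] the width drops by exactly the distance from [v] to [l + u]; the bounds on [v]
    keep the new width nonnegative. *)
Lemma shrunk_box_lt (n : nat) (l u v : 'cV[int]_n) :
  lecV l u -> v \in box (l + l) (u + u) -> v != l + u ->
  (\sum_j absz ((vmin u (v - l) - vmax l (v - u)) j 0)%R < \sum_j absz ((u - l) j 0)%R)%N.
Proof.
move=> lu /mem_box[lv vu] v_neq.
have shrink j : (absz ((vmin u (v - l) - vmax l (v - u)) j 0)%R + absz ((v - (l + u)) j 0)%R
    = absz ((u - l) j 0)%R)%N.
  by have := lu j; have := lv j; have := vu j; lia_entries.
under [ltnRHS]eq_bigr do rewrite -shrink.
rewrite big_split /= -[ltnLHS]addn0 ltn_add2l lt0n sum_nat_eq0.
apply: contra v_neq => /forallP v0; rewrite -subr_eq0; apply/eqP/matrixP=> j i.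
by rewrite ord1 [RHS]mxE; apply/eqP; rewrite -absz_eq0; have := v0 j.
Qed.

Lemma size_fiber_max (m n : nat) (M : 'M[int]_(m, n)) (b b' : 'cV[int]_m)
    (l u : 'cV[int]_n) : unimodular M -> M *m (l + u) = b + b ->
  (size (fiber M b' l u) <= size (fiber M b l u))%N.
Proof.
move=> hM; have [d] := ubnP (\sum_j absz ((u - l) j 0)%R)%N.
elim: d l u => // d IHd l u lt_d Mlu.
have [->|] := posnP (size (fiber M b' l u)); first exact: leq0n.
(* A point over [b'] shows that the box is nonempty, as the midpoint argument requires. *)
rewrite -has_predT => /hasP[y /mem_fiber[ly yu _] _].
have lu : lecV l u by move=> j; apply: le_trans (ly j) (yu j).
have N_gt0 := fiber_midpoint hM lu Mlu.
pose b'' := b + b - b'.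
have bE : b' + b'' = b + b by rewrite /b'' addrC subrK.
have sym : size (fiber M b'' l u) = size (fiber M b' l u).
  by rewrite /b'' -Mlu size_fiber_reflect.
have luE : l + u \in box (l + l) (u + u).
  by apply/mem_box; split=> j; have := lu j; lia_entries.
have diag c c' : c + c' = b + b ->
    pairs M c c' l u (l + u) = size (fiber M c l u).
  move=> cE; rewrite pairs_fiber ?cE // addrK [l + u]addrC addrK.
  by congr (size (fiber M c _ _)); apply/matrixP=> i j; rewrite !mxE ord1 ?maxxx ?minxx.
have off : (\sum_(v <- box (l + l)%R (u + u)%R | v != (l + u)%R) pairs M b' b'' l u v <=
            \sum_(v <- box (l + l)%R (u + u)%R | v != (l + u)%R) pairs M b b l u v)%N.
  rewrite big_seq_cond [leqRHS]big_seq_cond; apply: leq_sum => v /andP[vE v_neq].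
  have [Mv|Mv] := eqVneq (M *m v) (b + b); last by rewrite pairs_eq0 // bE.
  (* Both counts are fiber sizes in the same smaller box, whose corners sum to [v], so it is again
     centred over [b]. *)
  rewrite !pairs_fiber ?bE //; apply: IHd.
    by apply: leq_trans (shrunk_box_lt lu vE v_neq) _; rewrite -ltnS.
  rewrite -Mv; congr (_ *m _); apply/matrixP=> i j; rewrite ord1.
  by lia_entries.
have Nb := size_fiberM M b b l u; have Nb' := size_fiberM M b' b'' l u.
rewrite (bigD1_seq _ luE (uniq_box _ _)) diag //= in Nb.
rewrite (bigD1_seq _ luE (uniq_box _ _)) diag //= sym in Nb'.
move: Nb Nb' off N_gt0; move: (size (fiber M b l u)) (size (fiber M b' l u)).
move=> N N' NN N'N' off N_gt0; rewrite leqNgt; apply/negP => lt.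
(* Strictness needs [N > 0]: for [N = 0] and [N' = 1] both products vanish. *)
have : (N * N.-1 < N' * N'.-1)%N by rewrite ltn_mul //; lia.
by rewrite -!subn1 !mulnBr !muln1 NN N'N' !addKn ltnNge off.
Qed.

(** * Coefficients of the Laurent polynomial *)

Lemma monomialD (n : nat) (y z : 'cV[int]_n) :
  monomial (y + z) = monomial y * monomial z.
Proof.
rewrite /monomial -big_split /=; apply: eq_bigr => j _.
(* Adding integer exponents requires a nonzero base; the variable ['X_j] has coefficient 1 at its
   own monomial. *)
rewrite mxE expfzDr // tofrac_eq0; apply/eqP=> /(congr1 (mcoeff U_(j)%MM)).
by move/eqP; rewrite mcoeffX eqxx mcoeff0 oner_eq0.
Qed.

Lemma T_fiber (m n : nat) (M : 'M[int]_(m, n)) (b : 'cV[int]_m)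
    (k1 k2 : 'cV[int]_n) :
  T M b k1 k2 = \sum_(y <- fiber M b k1 k2) monomial y.
Proof.
rewrite /T (fsbigE _ _ (uniq_fiber M b k1 k2)).
- rewrite big_seq_cond [RHS]big_seq; apply: eq_bigl => y.
  apply: andb_idr => /mem_fiber y_fib; exact/mem_set.
- by move=> y /= /mem_fiber.
- by move=> y y_fib /negP[]; apply/mem_fiber.
Qed.

Lemma TM_pairs (m n : nat) (M : 'M[int]_(m, n)) (b1 b2 : 'cV[int]_m)
    (k1 k2 : 'cV[int]_n) :
  T M b1 k1 k2 * T M b2 k1 k2 =
  \sum_(v <- box (k1 + k1) (k2 + k2)) monomial v *+ pairs M b1 b2 k1 k2 v.
Proof.
rewrite !T_fiber big_distrlr -sum_pairs /=.
by under eq_bigr do under eq_bigr do rewrite -monomialD.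
Qed.

Lemma pairs_box (m n : nat) (M : 'M[int]_(m, n)) (b1 b2 : 'cV[int]_m)
    (l u v : 'cV[int]_n) :
  v \notin box (l + l) (u + u) -> pairs M b1 b2 l u v = 0%N.
Proof.
move=> vE; apply/eqP; rewrite -leqn0 leqNgt -has_count; apply: contra vE.
case/hasP=> y /mem_fiber[ly yu _] /mem_fiber[lvy vyu _]; apply/mem_box.
split=> j; first by have := ly j; have := lvy j; lia_entries.
by have := yu j; have := vyu j; lia_entries.
Qed.

Unset Implicit Arguments.

Theorem theorem3p1 (m n : nat) (M : 'M[int]_(m, n)) (b bp bm : 'cV[int]_m)
    (hM : unimodular M)
    (hb : ratmx b = 2^-1 *: (ratmx bp + ratmx bm))
    (k1 k2 : 'cV[int]_n) :
  laurent_nonneg (T M b k1 k2 ^+ 2 - T M bp k1 k2 * T M bm k1 k2).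
Proof.
have bE : bp + bm = b + b.
  apply/matrixP=> i j; move/matrixP/(_ i j): hb; rewrite !mxE => hb.
  by apply: (@intr_inj rat); rewrite !intrD; lra.
pose c v : int := (pairs M b b k1 k2 v)%:Z - (pairs M bp bm k1 k2 v)%:Z.
have c_box v : v \notin box (k1 + k1) (k2 + k2) -> c v = 0.
  by move=> vE; rewrite /c !pairs_box.
exists c; split; first split.
- apply: sub_finite_set (finite_box (k1 + k1) (k2 + k2)) => v /= cv.
  by apply/mem_box; apply: contraNT cv => /c_box ->.
- rewrite expr2 !TM_pairs -sumrB (fsbigE _ _ (uniq_box (k1 + k1) (k2 + k2))) //.
    apply: eq_big => [v|v _]; first by rewrite in_setT.
    by rewrite /c intrB mulrBl -!pmulrn !mulr_natl.
  by move=> v _ /c_box ->; rewrite mul0r.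
- move=> v; rewrite subr_ge0 lez_nat.
  (* If [M *m v] is not [b + b], the subtracted count is zero. Otherwise both counts live in one box
     with corners summing to [v], and the central fiber wins. *)
  have [Mv|Mv] := eqVneq (M *m v) (b + b); last by rewrite [leqLHS]pairs_eq0 // bE.
  rewrite !pairs_fiber ?bE //; apply: size_fiber_max => //.
  rewrite -Mv; congr (_ *m _); apply/matrixP=> i j; rewrite ord1.
  by lia_entries.
Qed.
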